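(* Let $B\subset\mathbb{R}^n$ be a centrally symmetric compact convex domain, let $d_B$ be the associated Minkowski distance on $\mathbb{R}^n$, and let $M\subset\mathbb{R}^n$ be a bounded set. For $r>0$ put $M_r=\{x\in\mathbb{R}^n : d_B(x,M)=r\}$. If $r$ is large enough, then the level set $M_r$ is a Lipschitz hypersurface in the Minkowski space $(\mathbb{R}^n,d_B)$. Furthermore, for arbitrary $r>0$ the level set $M_r$ is the union of finitely many Lipschitz hypersurfaces, and in particular it is an $(n-1)$-rectifiable subset of $\mathbb{R}^n$.
   Context: A centrally symmetric compact convex domain $B$ is a compact convex set with non-empty interior that is symmetric about its center. It determines the norm $\|\cdot\|_B$ on $\mathbb{R}^n$ whose unit ball is $B$ (translated so that its center is the origin), and $d_B(x,y)=\|x-y\|_B$, $d_B(x,M)=\inf_{m\in M}d_B(x,m)$. The Minkowski space is $\mathbb{R}^n$ equipped with the distance $d_B$. ''Lipschitz hypersurface'' has its usual meaning: an $(n-1)$-dimensional Lipschitz submanifold of $\mathbb{R}^n$, i.e. a subset which near each of its points is, in suitable linear coordinates, the graph of a Lipschitz real-valued function defined on an open subset of $\mathbb{R}^{n-1}$ (since all norms on $\mathbb{R}^n$ are equivalent, this does not depend on the norm used).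
   Formalization: For arbitrary r>0, M_r is shown to be a finite union of closed subsets of Lipschitz hypersurfaces, not of full ones; the literal claim fails for the Euclidean unit circle with r=1, where M_1 has the isolated point 0. *)

(* Defs.v *)
From HB Require Import structures.
From mathcomp Require Import all_boot all_order all_algebra.
From mathcomp Require Import all_classical all_reals all_analysis.

Set Implicit Arguments.
Unset Strict Implicit.
Unset Printing Implicit Defensive.

Import Order.TTheory GRing.Theory Num.Theory.
Import numFieldNormedType.Exports.

Local Open Scope classical_set_scope.
Local Open Scope ring_scope.

Section Minkowski.
Variables (R : realType) (n : nat).
Implicit Types (B M : set 'rV[R]_n) (c x y : 'rV[R]_n) (r : R).

Definition symmetric_convex_domain B c :=
  [/\ compact B, convex_set B, B° !=set0 &
      forall x, B x -> B (c *+ 2 - x)].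

(* The norm whose unit ball is B translated by - c, as a Minkowski gauge. *)
Definition Bnorm B c x : R := inf [set t : R | 0 < t /\ B (c + t^-1 *: x)].

Definition Bdist B c x y : R := Bnorm B c (x - y).

(* For M empty the distance should be +oo, while inf set0 = 0 in R; in either
   case the level sets of M at levels r > 0 are empty. *)
Definition Bdist_set B c x M : R := inf [set Bdist B c x m | m in M].

Definition level_set B c M r := [set x | Bdist_set B c x M = r].

End Minkowski.

(* In a neighbourhood U of p, S is the graph of f over the open set V, in the
   linear coordinates x |-> x *m invmx A, the height being coordinate 0.
   Lipschitz conditions are expressed with the sup norm, all norms on a
   finite-dimensional space being equivalent. *)
Definition lipschitz_hypersurface (R : realType) (n : nat)
    (S : set 'rV[R]_n.+1) : Prop :=
  forall p, S p ->
  exists (U : set 'rV[R]_n.+1) (A : 'M[R]_n.+1) (V : set 'rV[R]_n)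
         (f : 'rV[R]_n -> R),
    [/\ open_nbhs p U, A \in unitmx, open V, [lipschitz f w | w in V] &
        S `&` U =
          [set (row_mx (f w)%:M w : 'rV[R]_(1 + n)) *m A | w in V]].

(* Closed subset of a Lipschitz hypersurface. Level sets at small r need not be
   unions of full hypersurfaces: at r = 1, the level set of the Euclidean unit
   circle is a circle of radius 2 together with the isolated point 0. *)
Definition lipschitz_hypersurface_piece (R : realType) (n : nat)
    (S : set 'rV[R]_n.+1) : Prop :=
  closed S /\ exists2 H, lipschitz_hypersurface H & S `<=` H.

(* Federer's definition: E is a Lipschitz image of a bounded subset of R^m; the
   0-rectifiable sets are by convention the finite ones. *)
Definition rectifiable (R : realType) (m n : nat) (E : set 'rV[R]_n) : Prop :=
  if m is 0 then finite_set E else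
  exists (D : set 'rV[R]_m) (f : 'rV[R]_m -> 'rV[R]_n),
    [/\ bounded_set D, [lipschitz f w | w in D] & f @` D = E].

(* Main.v *)
Require Import Defs.
From HB Require Import structures.
From mathcomp Require Import all_boot all_order all_algebra.
From mathcomp Require Import all_classical all_reals all_analysis.
From mathcomp Require Import ring lra.
Import Order.TTheory GRing.Theory Num.Theory.
Import numFieldNormedType.Exports.
Local Open Scope classical_set_scope.
Local Open Scope ring_scope.

Set Implicit Arguments.
Unset Strict Implicit.
Unset Printing Implicit Defensive.

(* Let N be the norm with unit ball B and d the distance to M. If M has
   N-diameter at most D and d p = r > 2 D, then, for m0 in M, convexity of N
   makes d grow in the direction p - m0 at a uniform positive rate near p; since
   d is also Lipschitz, the level set near p is the graph of a Lipschitz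
   function. For an arbitrary r, M is cut into finitely many parts of diameter
   small with respect to r, and each point of the level set of M lies on the
   level set of one of the parts. Rectifiability follows by compactness, as
   finitely many graph patches cover the level set. *)

(** * Compactness, boundedness and Lipschitz maps *)

(** If [P K] failed, the sets [A] with [P (K \ A)] would form a proper filter containing [K]. It
    would cluster at some [x] in [K], yet contain the complement of the neighbourhood [U] of [x]. *)
Lemma compact_local_ind (T : topologicalType) (P : set T -> Prop) (K : set T) :
  P set0 -> (forall A C, P A -> P C -> P (A `|` C)) ->
  (forall A C, A `<=` C -> P C -> P A) ->
  (forall x, K x -> exists2 U, nbhs x U & P (U `&` K)) ->
  compact K -> P K.
Proof.
move=> P0 PU Psub Ploc cK; apply: contrapT => nPK.
pose F : set_system T := [set A | P (K `\` A)].
have FF : ProperFilter F.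
  split=> [|]; first by rewrite /F /= setD0.
  split=> [|A C FA FC|A C AC FA] /=; rewrite /F /=.
  - by rewrite setDT.
  - by rewrite setDIr; exact: PU.
  - by apply: Psub FA; exact: setDS.
have /(cK F)[x [Kx clx]] : F K by rewrite /F /= setDv.
have [U xU PUK] := Ploc x Kx.
have FU : F (~` U).
  by rewrite /F /= setDE setCK setIC.
by have [y [nUy Uy]] := clx _ _ FU xU.
Qed.

Lemma bounded_setP (K : realType) (V : normedModType K) (A : set V) :
  bounded_set A <-> exists2 C, 0 < C & forall x, A x -> `|x| <= C.
Proof.
split=> [/pinfty_ex_gt0[C C0 AC]|[C C0 AC]]; first by exists C.
exists C; split=> [|M /ltW CM x Ax]; first exact: num_real.
exact: le_trans (AC x Ax) CM.
Qed.

Section lipschitz_bounded.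
Context {K : realType} {V W : normedModType K}.
Implicit Types (D : set V) (f : V -> W).

Lemma lipschitz_onP f D : [lipschitz f x | x in D] <->
  exists2 k, 0 < k & forall x y, D x -> D y -> `|f x - f y| <= k * `|x - y|.
Proof.
split=> [/pinfty_ex_gt0[k k0 fk]|[k k0 fk]].
  by exists k => // x y Dx Dy; exact: (fk (x, y)).
exists k; split=> [|M /ltW kM [x y] [/= Dx Dy]]; first exact: num_real.
by rewrite (le_trans (fk _ _ Dx Dy))// ler_wpM2r.
Qed.

Lemma lipschitz_bounded_image f D :
  [lipschitz f x | x in D] -> bounded_set D -> bounded_set (f @` D).
Proof.
move=> /lipschitz_onP[k k0 fk] /bounded_setP[C C0 DC].
have [[a Da]|D0] := pselect (D !=set0); last first.
  apply/bounded_setP; exists 1 => // _ [x Dx <-]; exfalso; apply: D0.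
  by exists x.
apply/bounded_setP; exists (`|f a| + k * (C + C)).
  by rewrite ltr_wpDl// mulr_gt0// addr_gt0.
move=> _ [x Dx <-]; rewrite -[f x](subrK (f a)) addrC.
rewrite (le_trans (ler_normD _ _))// lerD2l (le_trans (fk _ _ _ _))//.
by rewrite ler_wpM2l ?(ltW k0)// (le_trans (ler_normB _ _))// lerD// DC.
Qed.

End lipschitz_bounded.

(** * Matrix norms and linear coordinates *)

Section matrix_norm.
Context {R : realType}.

Lemma le_mx_norm m n (x : 'M[R]_(m, n)) (e : R) :
  0 <= e -> (`|x| <= e <-> forall i j, `|x i j| <= e).
Proof.
move=> e0; rewrite /Num.Def.normr /= mx_normrE; split=> [/bigmax_leP[_ h] i j|h].
  exact: (h (i, j)).
by apply/bigmax_leP; split=> // -[i j] _; exact: h.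
Qed.

Lemma ler_mx_entry m n (x : 'M[R]_(m, n)) i j : `|x i j| <= `|x|.
Proof. by have /le_mx_norm := lexx `|x|; apply. Qed.

Lemma mulmx_norm_le m n (A : 'M[R]_(m, n)) :
  exists2 k, 0 < k & forall p (x : 'M[R]_(p, m)), `|x *m A| <= k * `|x|.
Proof.
exists (m%:R * `|A| + 1) => [|p x].
  by rewrite ltr_wpDl ?mulr_ge0.
apply/le_mx_norm => [|i j]; first by rewrite mulr_ge0// addr_ge0 ?mulr_ge0.
rewrite mxE (le_trans (ler_norm_sum _ _ _))//.
apply: (@le_trans _ _ (\sum_(l < m) `|A| * `|x|)).
  by apply: ler_sum => l _; rewrite normrM mulrC ler_pM// ler_mx_entry.
by rewrite sumr_const card_ord -[_ *+ m]mulr_natl mulrDl mul1r mulrA lerDl.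
Qed.

Lemma row_mx_norm_le m n1 n2 (x : 'M[R]_(m, n1)) (y : 'M[R]_(m, n2)) (e : R) :
  0 <= e -> (`|row_mx x y| <= e <-> `|x| <= e /\ `|y| <= e).
Proof.
move=> e0.
split=> [/(le_mx_norm _ e0) h|[/(le_mx_norm _ e0) hx /(le_mx_norm _ e0) hy]].
  split; apply/le_mx_norm => // i j.
    by have := h i (lshift _ j); rewrite row_mxEl.
  by have := h i (rshift _ j); rewrite row_mxEr.
apply/le_mx_norm => // i j; rewrite mxE.
by case: (fintype.split j) => l; [exact: hx|exact: hy].
Qed.

Lemma scalar_mx_norm (a : R) : `|a%:M : 'M[R]_1| = `|a|.
Proof.
apply/eqP; rewrite eq_le; apply/andP; split.
  by apply/le_mx_norm => // i j; rewrite !ord1 mxE eqxx mulr1n.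
by have := ler_mx_entry (a%:M : 'M[R]_1) 0 0; rewrite mxE eqxx mulr1n.
Qed.

End matrix_norm.

(** Gives linear coordinates whose coordinate 0 runs along [e]. In the rank factorization of [e] the
    left factor is 1 by 1, so [e] is a nonzero multiple of the first row of an invertible matrix. *)
Lemma unitmx_row0 (F : fieldType) n (e : 'rV[F]_n.+1) : e != 0 ->
  exists2 A : 'M[F]_n.+1, A \in unitmx &
    forall a w, (row_mx a%:M w : 'rV[F]_(1 + n)) *m A =
      a *: e + (row_mx 0 w : 'rV[F]_(1 + n)) *m A.
Proof.
move=> e0; have re : \rank e = 1%N by rewrite rank_rV e0.
have := mulmx_ebase e; rewrite re; set C := col_ebase e; set Q := row_ebase e.
have Cu : C 0 0 != 0.
  have := col_ebase_unit e; rewrite -/C unitmxE [C]mx11_scalar det_scalar expr1.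
  by rewrite mxE eqxx mulr1n unitfE.
move=> eE; exists (C 0 0 *: Q).
  by rewrite unitmxZ ?unitfE// row_ebase_unit.
have {}eE : (row_mx 1%:M 0 : 'rV[F]_(1 + n)) *m (C 0 0 *: Q) = e.
  rewrite -[RHS]eE [X in _ = X *m _ *m _]mx11_scalar mul_scalar_mx -pid_mx_row.
  by rewrite -scalemxAr -scalemxAl.
move=> a w; rewrite -[in RHS]eE scalemxAl -mulmxDl; congr (_ *m _).
by rewrite scale_row_mx add_row_mx scaler0 add0r addr0 scale_scalar_mx mulr1.
Qed.

(** * Level sets of functions increasing in a transverse direction *)

Lemma lipschitz_continuous (K : realType) (V W : normedModType K)
    (f : V -> W) (k : K) : 0 < k ->
  (forall x y, `|f x - f y| <= k * `|x - y|) -> continuous f.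
Proof.
move=> k0 fk x; apply/cvgrPdist_le => /= e e0; near=> y.
rewrite (le_trans (fk _ _))// -ler_pdivlMl//; near: y.
by apply: cvgr_dist_le; rewrite ?mulr_gt0// invr_gt0.
Unshelve. all: by end_near. Qed.

(* Over a small ball V of coordinates w transverse to e, the function
   a |-> g (a *: e + w) increases with slope at least kappa, so it takes the
   value r exactly once; the Lipschitz bound L for g makes that solution
   Lipschitz in w, with a constant proportional to L / kappa. *)
Lemma transverse_level_lipschitz_hypersurface (R : realType) n
    (g : 'rV[R]_n.+1 -> R) (r L : R) : 0 < L ->
  (forall x y, `|g x - g y| <= L * `|x - y|) ->
  (forall p, g p = r -> exists (e : 'rV[R]_n.+1) (delta kappa : R),
    [/\ 0 < delta, 0 < kappa & forall x t, `|x - p| < delta -> 0 <= t ->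
      g x + kappa * t <= g (x + t *: e)]) ->
  lipschitz_hypersurface [set x | g x = r].
Proof.
move=> L0 gL gr p gp; have [e [delta [kappa [d0 k0 slope]]]] := gr p gp.
have e0 : e != 0.
  apply/eqP => e0; have := slope p 1; rewrite subrr normr0 d0 ler01 e0.
  by rewrite scaler0 addr0 mulr1 => /(_ erefl erefl); lra.
have [A uA Ae] := unitmx_row0 e0.
have [kA kA0 normA] := mulmx_norm_le A.
have [kI kI0 normI] := mulmx_norm_le (invmx A).
pose emb a w : 'rV[R]_n.+1 := (row_mx a%:M w : 'rV[R]_(1 + n)) *m A.
pose xa (x : 'rV[R]_n.+1) : R := lsubmx (x *m invmx A : 'rV[R]_(1 + n)) 0 0.
pose xw (x : 'rV[R]_n.+1) : 'rV[R]_n :=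
  rsubmx (x *m invmx A : 'rV[R]_(1 + n)).
have embK x : emb (xa x) (xw x) = x.
  by rewrite /emb /xa -mx11_scalar hsubmxK mulmxKV.
have xaE a w : xa (emb a w) = a.
  by rewrite /xa /emb mulmxK// row_mxKl mxE eqxx mulr1n.
have xwE a w : xw (emb a w) = w by rewrite /xw /emb mulmxK// row_mxKr.
have embD a t w : emb (a + t) w = emb a w + t *: e.
  by rewrite /emb !Ae scalerDl -!addrA [t *: e + _]addrC.
have embB a w a' w' : emb a w - emb a' w' = emb (a - a') (w - w').
  rewrite /emb -mulmxBl; congr (_ *m _).
  by rewrite opp_row_mx add_row_mx -raddfB.
have emb_le a w (s : R) : 0 <= s -> `|a| <= s -> `|w| <= s ->
    `|emb a w| <= kA * s.
  move=> s0 sa sw; rewrite (le_trans (normA _ _))// ler_pM2l//.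
  have [_ h] := row_mx_norm_le a%:M w s0; apply: h.
  by rewrite scalar_mx_norm.
have xB x y : (x - y) *m invmx A =
    row_mx (xa x - xa y)%:M (xw x - xw y) :> 'rV[R]_(1 + n).
  by rewrite -[x in LHS]embK -[y in LHS]embK embB /emb mulmxK.
have xB_le x y : `|xa x - xa y| <= kI * `|x - y| /\
                 `|xw x - xw y| <= kI * `|x - y|.
  rewrite -(scalar_mx_norm (xa x - xa y)).
  have s0 : 0 <= kI * `|x - y| by rewrite mulr_ge0// ltW.
  have [h _] := row_mx_norm_le (xa x - xa y)%:M (xw x - xw y) s0; apply: h.
  by have := normI _ (x - y); rewrite xB.
have xaC : continuous xa.
  by apply: (lipschitz_continuous kI0) => x y; case: (xB_le x y).
have xwC : continuous xw.
  by apply: (lipschitz_continuous kI0) => x y; case: (xB_le x y).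
pose a0 := xa p; pose w0 := xw p.
(* The box of half-width [eta] in the coordinates [(a, w)] lands in the ball of radius [delta]
   around [p]. *)
pose eta := delta / (2 * kA).
have eta0 : 0 < eta by rewrite divr_gt0// mulr_gt0.
have kAeta : kA * eta < delta.
  rewrite /eta; have -> : kA * (delta / (2 * kA)) = delta / 2.
    by field; rewrite gt_eqF.
  by lra.
(* The second bound keeps the variation of [g] in [w] below [kappa * eta / 2], the rise guaranteed
   when [a] moves by [eta / 2]. *)
pose eta' := Num.min eta (kappa * eta / (2 * (L * kA))).
have eta'0 : 0 < eta'.
  rewrite lt_min eta0/=; apply: divr_gt0; first exact: mulr_gt0.
  by rewrite mulr_gt0// mulr_gt0.
have eta'_le : eta' <= eta by rewrite ge_min lexx.
have eta'_L : L * kA * eta' <= kappa * eta / 2.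
  have : eta' <= kappa * eta / (2 * (L * kA)) by rewrite ge_min lexx orbT.
  rewrite ler_pdivlMr ?mulr_gt0//; lra.
have slope' a w t : `|a - a0| < eta -> `|w - w0| < eta' -> 0 <= t ->
    g (emb a w) + kappa * t <= g (emb (a + t) w).
  move=> aeta weta t0; rewrite embD slope//.
  rewrite -(embK p) embB (le_lt_trans _ kAeta)// emb_le ?(ltW eta0) ?(ltW aeta)//.
  by rewrite (le_trans (ltW weta)).
have gw a w w' : `|g (emb a w) - g (emb a w')| <= L * kA * `|w - w'|.
  rewrite (le_trans (gL _ _))// -mulrA ler_pM2l// embB subrr emb_le//.
  by rewrite normr0.
(* The condition on [w] sits under the existential so that [choice] yields a total [f]; 0 is the
   default outside the ball. *)
have root w : exists a, `|w - w0| < eta' -> `|a - a0| < eta /\ g (emb a w) = r.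
  have [wV|] := boolP (`|w - w0| < eta'); last by exists 0.
  have := gw a0 w w0; rewrite [emb a0 w0]embK gp => gw0.
  have {gw0} : `|g (emb a0 w) - r| <= kappa * eta / 2.
    by rewrite (le_trans gw0)// (le_trans _ eta'_L)// ler_pM2l ?mulr_gt0// ltW.
  rewrite ler_norml => /andP[glo ghi].
  (* At [a0 - eta / 2] and [a0 + eta / 2] the values of [g] are on either side of [r], whence a root
     by the intermediate value theorem. *)
  have h1 := slope' a0 w (eta / 2).
  have h2 := slope' (a0 - eta / 2) w (eta / 2).
  rewrite subrr normr0 in h1.
  have e2 : 0 <= eta / 2 by lra.
  have e3 : `|a0 - eta / 2 - a0| < eta.
    by rewrite addrAC subrr sub0r normrN ger0_norm//; lra.
  have {}h1 := h1 eta0 wV e2.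
  have {}h2 := h2 e3 wV e2; rewrite subrK in h2.
  have le2 : a0 - eta / 2 <= a0 + eta / 2 by lra.
  have ctn : continuous (fun a => g (emb a w)).
    apply: (@lipschitz_continuous _ _ _ _ (L * kA)); first exact: mulr_gt0.
    move=> a a'; rewrite (le_trans (gL _ _))// -mulrA ler_pM2l// embB subrr.
    by rewrite emb_le// normr0.
  have /(_ r) := IVT le2 (@continuous_subspaceT _ _ _ _ ctn).
  rewrite ge_min le_max => -[].
    by apply/andP; split; apply/orP; [left|right]; lra.
  move=> a; rewrite in_itv/= => /andP[al ar] ga; exists a => _; split=> //.
  by rewrite ltr_norml; lra.
have {root} [f fP] := choice root.
exists ((xa @^-1` ball a0 eta) `&` (xw @^-1` ball w0 eta')), A,
  (ball w0 eta'), f.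
have ballwE w : ball w0 eta' w = (`|w - w0| < eta') :> Prop.
  by rewrite -ball_normE /= distrC.
have ballaE a : ball a0 eta a = (`|a - a0| < eta) :> Prop.
  by rewrite -ball_normE /= distrC.
split=> //.
- split; last by split; exact: ballxx.
  by apply: openI; apply: open_comp; rewrite ?ball_normE//; exact: ball_open.
- exact: ball_open.
- apply/lipschitz_onP; exists (L * kA / kappa); first by rewrite divr_gt0// mulr_gt0.
  suff h w w' : `|w - w0| < eta' -> `|w' - w0| < eta' ->
      f w' - f w <= L * kA / kappa * `|w - w'|.
    move=> w w'; rewrite !ballwE => wV wV'; rewrite ler_norml lerNl opprB h//=.
    by rewrite distrC h.
  move=> wV wV'; have [fle|/ltW fle] := leP (f w') (f w).
    by rewrite (@le_trans _ _ 0) ?subr_le0// mulr_ge0// divr_ge0 ?mulr_ge0// ltW.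
  have [faw gfw] := fP _ wV; have [faw' gfw'] := fP _ wV'.
  (* Climbing over [w'] from height [f w] to [f w'] raises [g] by at least [kappa * (f w' - f w)]
     and ends at [r]; the start is within [L * kA * |w - w'|] of [r]. *)
  have := slope' (f w) w' (f w' - f w) faw wV'; rewrite subr_ge0 => /(_ fle).
  rewrite [_ + (_ - _)]addrC subrK gfw'.
  have := gw (f w) w w'; rewrite gfw ler_norml => /andP[_ gw1] gw2.
  rewrite mulrAC ler_pdivlMr//; lra.
- apply/seteqP; split=> [x [/= gx]|_ [w wV <-]].
    rewrite ballaE ballwE => -[xaV xwV]; exists (xw x); first by rewrite ballwE.
    have [fa gf] := fP _ xwV; suff -> : f (xw x) = xa x by exact: embK.
    (* Over one [w], two distinct heights cannot both give the value [r], since [g] increases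
       strictly between them. *)
    have [fx|fx|//] := ltgtP (f (xw x)) (xa x).
      have := slope' (f (xw x)) (xw x) (xa x - f (xw x)) fa xwV.
      rewrite [_ + (_ - _)]addrC subrK subr_ge0 (ltW fx) gf embK gx => /(_ erefl).
      have : 0 < kappa * (xa x - f (xw x)) by rewrite mulr_gt0// subr_gt0.
      lra.
    have := slope' (xa x) (xw x) (f (xw x) - xa x) xaV xwV.
    rewrite [_ + (_ - _)]addrC subrK subr_ge0 (ltW fx) gf embK gx => /(_ erefl).
    have : 0 < kappa * (f (xw x) - xa x) by rewrite mulr_gt0// subr_gt0.
    lra.
  have [faw gfw] : `|f w - a0| < eta /\ g (emb (f w) w) = r.
    by apply: fP; rewrite -ballwE.
  split=> //=; rewrite -/(emb (f w) w) xaE xwE; split=> //.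
  by rewrite ballaE.
Qed.

(** * The gauge of a symmetric convex domain is a norm *)

Section gauge.
Context {R : realType} {n : nat} {B : set 'rV[R]_n} {c : 'rV[R]_n}.
Hypothesis hB : symmetric_convex_domain B c.
Local Notation N := (Bnorm B c).

Let gauge_set (x : 'rV[R]_n) := [set t : R | 0 < t /\ B (c + t^-1 *: x)].

Let gauge_lbound x : has_lbound (gauge_set x).
Proof. by exists 0 => t [/ltW]. Qed.

Let gauge_le x t : gauge_set x t -> N x <= t.
Proof. exact: ge_inf. Qed.

Lemma domain_convex (x y : 'rV[R]_n) (s t : R) : B x -> B y ->
  0 <= s -> 0 <= t -> s + t = 1 -> B (s *: x + t *: y).
Proof.
case: hB => _ Bconv _ _ Bx By s0 t0 st; have s1 : s <= 1 by lra.
have -> : t = 1 - s by lra.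
have := Bconv x y (Itv01 s0 s1); rewrite !inE => /(_ Bx By).
by rewrite /conv /= /unstable.onem.
Qed.

(* The interior point b and its mirror image 2c - b are averaged to make the
   center c interior. *)
Lemma domain_nbhs_center :
  exists2 eps : R, 0 < eps & forall v, `|v| < eps -> B (c + v).
Proof.
case: hB => _ _ [b] /nbhs_ballP[/= eps eps0 bB] Bsym; exists eps => // v veps.
have Bp : B (b + v).
  by apply: bB; rewrite -ball_normE /= opprD addrA subrr sub0r normrN.
have Bm : B (c *+ 2 - (b - v)).
  by apply/Bsym/bB; rewrite -ball_normE /= opprB addrC subrK.
have := domain_convex (s := 2^-1) (t := 2^-1) Bp Bm.
rewrite -scalerDr; have -> : b + v + (c *+ 2 - (b - v)) = (c + v) *+ 2.
  by apply/matrixP => i j; rewrite !mulr2n !mxE; ring.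
rewrite -[(c + v) *+ 2]scaler_nat scalerA mulVf ?pnatr_eq0// scale1r; apply; lra.
Qed.

(** A ball of radius [eps] around [c] lies in [B], so every [t] above [|x| / eps] is admissible.
    Hence the gauge set is non-empty and its [inf] is a genuine infimum. *)
Let gauge_set_large :
  exists2 k : R, 0 < k & forall x t, k * `|x| < t -> gauge_set x t.
Proof.
have [eps eps0 cB] := domain_nbhs_center.
exists eps^-1; first by rewrite invr_gt0.
move=> x t xt; have t0 : 0 < t.
  by rewrite (le_lt_trans _ xt)// mulr_ge0// invr_ge0 ltW.
split=> //; apply: cB; rewrite normrZ gtr0_norm ?invr_gt0//.
by rewrite ltr_pdivrMl// mulrC -ltr_pdivrMl.
Qed.

Let gauge_set_neq0 x : gauge_set x !=set0.
Proof.
have [k k0 h] := gauge_set_large; exists (k * `|x| + 1); apply: h; lra.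
Qed.

Let le_gauge x s : (forall t, gauge_set x t -> s <= t) -> s <= N x.
Proof. move=> h; exact: (lb_le_inf (gauge_set_neq0 x)). Qed.

Lemma Bnorm_le_norm : exists2 k : R, 0 < k & forall x, N x <= k * `|x|.
Proof.
have [k k0 h] := gauge_set_large; exists k => // x.
by apply/ler_addgt0Pr => e e0; apply/gauge_le/h; rewrite ltrDl.
Qed.

(** [B] is bounded by some [C], so [c + t^-1 *: x] in [B] forces [|x| / t <= C + |c|]. *)
Lemma norm_le_Bnorm : exists2 k : R, 0 < k & forall x, `|x| <= k * N x.
Proof.
case: (hB) => /compact_bounded/bounded_setP[C C0 BC] _ _ _.
exists (C + `|c|); first by rewrite ltr_pwDl.
move=> x; rewrite mulrC -ler_pdivrMr ?ltr_pwDl//; apply: le_gauge => t [t0 /BC xC].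
rewrite ler_pdivrMr ?ltr_pwDl// -ler_pdivrMl//.
have -> : t^-1 * `|x| = `|c + t^-1 *: x - c|.
  by rewrite addrC addKr normrZ gtr0_norm ?invr_gt0.
by rewrite (le_trans (ler_normB _ _))// lerD2r.
Qed.

Lemma Bnorm_ge0 x : 0 <= N x.
Proof. by apply: le_gauge => t [/ltW]. Qed.

Lemma BnormD x y : N (x + y) <= N x + N y.
Proof.
rewrite -lerBlDr; apply: le_gauge => s [s0 Bs].
rewrite lerBlDr -lerBlDl; apply: le_gauge => t [t0 Bt].
rewrite lerBlDr; apply: gauge_le; have ts0 : 0 < t + s by rewrite addr_gt0.
split=> //.
(* A convex combination of two points of [B]. *)
have -> : c + (t + s)^-1 *: (x + y) =
    (s / (t + s)) *: (c + s^-1 *: x) + (t / (t + s)) *: (c + t^-1 *: y).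
  rewrite !scalerDr !scalerA addrACA -scalerDl; congr (_ + (_ *: _ + _ *: _)).
  - by rewrite -mulrDl [s + t]addrC divff ?scale1r// gt_eqF.
  - by field; rewrite !gt_eqF.
  - by field; rewrite !gt_eqF.
apply: domain_convex => //; rewrite ?divr_ge0// ?ltW//.
by rewrite -mulrDl [s + t]addrC divff// gt_eqF.
Qed.

Lemma BnormN x : N (- x) = N x.
Proof.
suff h y : N (- y) <= N y.
  by apply/eqP; rewrite eq_le h/= -{1}[x]opprK h.
apply: le_gauge => t [t0 Bt]; apply: gauge_le; split=> //.
case: hB => _ _ _ /(_ _ Bt); rewrite opprD mulr2n addrA addrK.
by rewrite scalerN.
Qed.

Lemma BnormZ (t : R) x : 0 < t -> N (t *: x) = t * N x.
Proof.
(* The reverse inequality is this one for the scalar [t^-1] and the vector [t *: x]. *)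
suff h s y : 0 < s -> N (s *: y) <= s * N y.
  move=> t0; apply/eqP; rewrite eq_le h//= -ler_pdivlMl//.
  by rewrite (le_trans _ (h _ _ _)) ?invr_gt0// scalerK// gt_eqF.
move=> s0; rewrite -ler_pdivrMl//; apply: le_gauge => u [u0 Bu].
rewrite ler_pdivrMl//; apply: gauge_le; split; first exact: mulr_gt0.
by rewrite invfM scalerA mulrAC mulVf ?mul1r// gt_eqF.
Qed.

(** * The distance to a set and its level sets *)

Section distance_to_set.
Context (M : set 'rV[R]_n).
Local Notation d x := (Bdist_set B c x M).

Lemma Bdist_set_le x m : M m -> d x <= N (x - m).
Proof.
move=> Mm; apply: ge_inf; last by exists m.
by exists 0 => _ [y _ <-]; exact: Bnorm_ge0.
Qed.

Lemma le_Bdist_set x r : M !=set0 -> (forall m, M m -> r <= N (x - m)) ->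
  r <= d x.
Proof.
move=> [m Mm] h; apply: lb_le_inf; first by exists (N (x - m)), m.
by move=> _ [y My <-]; exact: h.
Qed.

(** By the convention [inf set0 = 0], an empty [M] is at distance 0 from every point, so its
    positive level sets are empty. *)
Lemma level_set_neq0 r x : 0 < r -> level_set B c M r x -> M !=set0.
Proof.
move=> r0 /= xr; apply/set0P/eqP => M0; move: r0.
by rewrite -xr /Bdist_set M0 image_set0 inf0 ltxx.
Qed.

Lemma Bdist_set_lt x e : M !=set0 -> 0 < e -> exists2 m, M m & N (x - m) < d x + e.
Proof.
move=> M0 e0; apply: contrapT => h.
have : d x + e <= d x.
  apply: le_Bdist_set => // m Mm; rewrite leNgt; apply/negP => hm.
  by apply: h; exists m.
by rewrite gerDl leNgt e0.
Qed.

Lemma Bdist_set_lipschitz : exists2 L : R, 0 < L &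
  forall x y, `|d x - d y| <= L * `|x - y|.
Proof.
have [L L0 NL] := Bnorm_le_norm; exists L => //.
have [M0|/set0P/negP/negPn/eqP M0] := pselect (M !=set0); last first.
  by move=> x y; rewrite /Bdist_set M0 !image_set0 subrr normr0 mulr_ge0// ltW.
suff h x y : d x - d y <= L * `|x - y|.
  by move=> x y; rewrite ler_norml h andbT lerNl opprB distrC h.
rewrite lerBlDr -lerBlDl; apply: le_Bdist_set => // m Mm.
rewrite lerBlDr (le_trans (Bdist_set_le _ Mm))//.
have -> : x - m = (y - m) + (x - y) by rewrite [RHS]addrC addrA subrK.
by rewrite (le_trans (BnormD _ _))// lerD2l.
Qed.

Lemma Bdist_set_continuous : continuous (fun x => d x).
Proof.
by have [L L0 dL] := Bdist_set_lipschitz; exact: lipschitz_continuous dL.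
Qed.

Lemma level_set_closed r : closed (level_set B c M r).
Proof.
apply: (@preimage_closed _ _ (fun x => d x) [set r]).
  by move=> x _; exact: Bdist_set_continuous.
exact: closed_eq.
Qed.

Lemma level_set_compact r : bounded_set M -> 0 < r ->
  compact (level_set B c M r).
Proof.
move=> /bounded_setP[C C0 MC] r0.
apply: bounded_closed_compact; last exact: level_set_closed.
have [k k0 Nk] := norm_le_Bnorm.
(* A point at level [r] is within [N]-distance [r + 1] of some point of [M], whose norm is at most
   [C]. *)
apply/bounded_setP; exists (k * (r + 1) + C).
  by rewrite addr_gt0// mulr_gt0// addr_gt0.
move=> x xr; have M0 := level_set_neq0 r0 xr.
have [m Mm xm] := Bdist_set_lt x M0 ltr01.
rewrite -[x](subrK m) (le_trans (ler_normD _ _))// lerD ?MC//.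
by rewrite (le_trans (Nk _))// ler_pM2l// ltW// -[in r + 1]xr.
Qed.

(* Convexity of N along e := p - m0: for y = x - m with x near p, y - e is
   short while y is long, so N grows at y in direction e at a rate at least
   N y - N (y - e). *)
Lemma Bdist_set_slope (D r delta : R) (p m0 x : 'rV[R]_n) (t : R) :
  (forall m m', M m -> M m' -> N (m - m') <= D) -> M m0 -> d p = r ->
  N (x - p) <= delta -> 0 <= t ->
  d x + (r - 2 * delta - 2 * D) * t <= d (x + t *: (p - m0)).
Proof.
move=> MD Mm0 dp xp; rewrite le_eqVlt => /predU1P[<-|t0].
  by rewrite mulr0 addr0 scale0r addr0.
apply: le_Bdist_set; first by exists m0.
move=> m Mm; have dx := Bdist_set_le x Mm.
set e := p - m0; set y := x - m.
have -> : x + t *: e - m = y + t *: e by rewrite addrAC.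
have Ne : r <= N e by rewrite -dp Bdist_set_le.
have Nye : N (y - e) <= delta + D.
  have -> : y - e = (x - p) + (m0 - m) by apply/matrixP => i j; rewrite !mxE; ring.
  by rewrite (le_trans (BnormD _ _))// lerD// MD.
have Ney : N e <= N y + N (y - e).
  rewrite -(BnormN (y - e)); have {1}-> : e = y + - (y - e) by rewrite subKr.
  exact: BnormD.
(* [y] is a convex combination of [y + t *: e] and [y - e], with weights proportional to 1 and
   [t]. *)
have conv : (1 + t) * N y <= N (y + t *: e) + t * N (y - e).
  rewrite -!BnormZ ?addr_gt0//.
  have -> : (1 + t) *: y = (y + t *: e) + t *: (y - e).
    by apply/matrixP => i j; rewrite !mxE; ring.
  exact: BnormD.
(* [N y - N (y - e) >= N e - 2 * N (y - e)], by [Ney]. *)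
have : t * (r - 2 * (delta + D)) <= t * (N y - N (y - e)).
  by rewrite ler_pM2l//; lra.
lra.
Qed.

End distance_to_set.

(** If neither part is at distance exactly [r], both stay farther than [r] by a fixed margin, hence
    so does the union. Only an inclusion holds: a point at distance [r] from one part may be closer
    to the other. *)
Lemma level_set_setU_sub (M1 M2 : set 'rV[R]_n) r : 0 < r ->
  level_set B c (M1 `|` M2) r `<=` level_set B c M1 r `|` level_set B c M2 r.
Proof.
move=> r0 x xr; have [m0 Mm0] := level_set_neq0 r0 xr.
have le12 (M' : set 'rV[R]_n) : M' `<=` M1 `|` M2 -> M' !=set0 ->
    r <= Bdist_set B c x M'.
  move=> M'12 M'0; apply: le_Bdist_set => // m M'm.
  by rewrite -xr; apply/Bdist_set_le/M'12.
apply: contrapT => /not_orP[n1 n2].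
have far (M' : set 'rV[R]_n) : M' `<=` M1 `|` M2 -> Bdist_set B c x M' <> r ->
    exists2 s, r < s & forall m, M' m -> s <= N (x - m).
  move=> M'12 M'r; have [M'0|M'0] := pselect (M' !=set0); last first.
    (* For an empty part [Bdist_set] has the default value 0, so any bound above [r] is used
       instead. *)
    exists (r + 1); first by rewrite ltrDl.
    by move=> m M'm; exfalso; apply: M'0; exists m.
  exists (Bdist_set B c x M') => [|m M'm]; last exact: Bdist_set_le.
  by rewrite lt_neqAle le12// andbT eq_sym; exact/eqP.
have [s1 rs1 h1] := far _ (@subsetUl _ M1 M2) n1.
have [s2 rs2 h2] := far _ (@subsetUr _ M1 M2) n2.
have : Num.min s1 s2 <= r.
  rewrite -xr; apply: le_Bdist_set; first by exists m0.
  by move=> m [/h1|/h2] h; rewrite ge_min h ?orbT.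
by rewrite leNgt lt_min rs1 rs2.
Qed.

Lemma Bdist_set_subset (M1 M2 : set 'rV[R]_n) x : M1 !=set0 -> M1 `<=` M2 ->
  Bdist_set B c x M2 <= Bdist_set B c x M1.
Proof.
by move=> M10 M12; apply: le_Bdist_set => // m /M12; exact: Bdist_set_le.
Qed.

End gauge.

(** * Level sets as hypersurfaces and as finite unions of pieces *)

Section level_sets.
Context {R : realType} {n : nat} {B : set 'rV[R]_n.+1} {c : 'rV[R]_n.+1}.
Hypothesis hB : symmetric_convex_domain B c.

Lemma level_set_lipschitz_hypersurface (M : set 'rV[R]_n.+1) (D r : R) :
  (forall m m', M m -> M m' -> Bnorm B c (m - m') <= D) ->
  0 < r -> 2 * D < r -> lipschitz_hypersurface (level_set B c M r).
Proof.
move=> MD r0 Dr; have [L L0 dL] := Bdist_set_lipschitz hB M.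
apply: (transverse_level_lipschitz_hypersurface L0 dL) => p dp.
have [m0 Mm0] := level_set_neq0 r0 dp.
have [k k0 Nk] := Bnorm_le_norm hB.
(* This makes the slope equal to [(r - 2 * D) / 2]; dividing by [k] turns the [N]-radius [delta]
   into a sup-norm radius. *)
pose delta := (r - 2 * D) / 4.
exists (p - m0), (delta / k), (r - 2 * delta - 2 * D); split.
- by rewrite divr_gt0// /delta; lra.
- by rewrite /delta; lra.
move=> x t xp t0; apply: Bdist_set_slope => //.
by rewrite (le_trans (Nk _))// mulrC -ler_pdivlMr// ltW.
Qed.

Lemma level_set_pieces (M : set 'rV[R]_n.+1) (r : R) : bounded_set M -> 0 < r ->
  exists (k : nat) (S : 'I_k -> set 'rV[R]_n.+1),
    (forall i, lipschitz_hypersurface_piece (S i)) /\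
    level_set B c M r = \bigcup_(i in [set: 'I_k]) S i.
Proof.
move=> /bounded_setP[C C0 MC] r0.
(* Intersecting with the level set of [M] discards the points at distance [r] from the part [A] but
   closer to the rest of [M]. *)
pose lev A := level_set B c M r `&` level_set B c (A `&` M) r.
pose P (A : set 'rV[R]_n.+1) := exists k (S : 'I_k -> set 'rV[R]_n.+1),
  (forall i, lipschitz_hypersurface_piece (S i) /\ S i `<=` level_set B c M r)
  /\ lev A `<=` \bigcup_(i in [set: 'I_k]) S i.
(* Compactness is applied to a closed ball containing the bounded set [M]. *)
suff [k [S [Spiece Scover]]] : P (closed_ball_ Num.Def.normr 0 C).
  exists k, S; split=> [i|]; first by case: (Spiece i).
  apply/seteqP; split=> [x xr|x [i _]]; last by case: (Spiece i) => _; exact.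
  apply: Scover; split=> //; rewrite (_ : _ `&` M = M)//.
  by apply/setIidPr => y /MC; rewrite /closed_ball_/= sub0r normrN.
apply: compact_local_ind.
- exists 0, (fun=> set0); split=> [[]//|x [_]].
  by rewrite set0I => /(level_set_neq0 r0)[].
- move=> A1 A2 [k1 [S1 [S1p S1c]]] [k2 [S2 [S2p S2c]]].
  exists (k1 + k2)%N, (fun i =>
    match fintype.split i with inl j => S1 j | inr j => S2 j end).
  split=> [i|x [xr]]; first by case: fintype.split.
  rewrite setIUl => /(level_set_setU_sub hB r0)[] xA.
    have [i _ Si] : (\bigcup_(i in [set: 'I_k1]) S1 i) x by apply: S1c.
    by exists (lshift k2 i) => //; rewrite (unsplitK (inl i)).
  have [i _ Si] : (\bigcup_(i in [set: 'I_k2]) S2 i) x by apply: S2c.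
  by exists (rshift k1 i) => //; rewrite (unsplitK (inr i)).
(* A point at distance [r] from both [M] and [A1 & M] is at distance [r] from the intermediate set
   [A2 & M]. *)
- move=> A1 A2 A12 [k [S [Sp Sc]]]; exists k, S; split=> // x [xr xA1].
  apply: Sc; split=> //=; have A1M := level_set_neq0 r0 xA1.
  have A12M : A1 `&` M `<=` A2 `&` M by move=> y [/A12 ? ?].
  have A2M : A2 `&` M !=set0 by case: A1M => y /A12M; exists y.
  apply/eqP; rewrite eq_le -{1}xA1 Bdist_set_subset//= -xr.
  by apply: Bdist_set_subset => // y [].
- move=> p _; have [k k0 Nk] := Bnorm_le_norm hB.
  (* The ball of radius [eps] then has [N]-diameter at most [r / 4], and twice this is less than
     [r]. *)
  pose eps := r / (8 * k); have eps0 : 0 < eps by rewrite divr_gt0// mulr_gt0.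
  exists (ball p eps); first exact: nbhsx_ballx.
  exists 1%N, (fun=> lev (ball p eps `&` closed_ball_ Num.Def.normr 0 C)).
  split=> [_|x xl]; last by exists ord0.
  split; last exact: subIsetl.
  split; first by apply: closedI; exact: level_set_closed.
  exists (level_set B c (ball p eps `&` closed_ball_ Num.Def.normr 0 C `&` M) r);
    last exact: subIsetr.
  apply: (@level_set_lipschitz_hypersurface _ (k * (2 * eps))) => //.
    move=> m m' [[pm _] _] [[pm' _] _]; rewrite (le_trans (Nk _))// ler_pM2l//.
    move: pm pm'; rewrite -!ball_normE /= => pm pm'.
    have -> : m - m' = (p - m') - (p - m) by rewrite opprB [RHS]addrC addrA subrK.
    by rewrite (le_trans (ler_normB _ _))//; lra.
  have -> : 2 * (k * (2 * eps)) = r / 2 by rewrite /eps; field; rewrite gt_eqF.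
  lra.
- apply: bounded_closed_compact; last exact: closed_closed_ball_.
  apply/bounded_setP; exists C => // x.
  by rewrite /closed_ball_/= sub0r normrN.
Qed.

End level_sets.

(** * Rectifiable sets *)

Section rectifiable_sets.
Context {R : realType}.

Lemma rectifiable_set0 m n : rectifiable m (set0 : set 'rV[R]_n).
Proof.
case: m => [|m]; first exact: finite_set0.
exists set0, (fun=> 0); split; last by rewrite image_set0.
  by apply/bounded_setP; exists 1.
by apply/lipschitz_onP; exists 1.
Qed.

(** The domain of a parametrization is an arbitrary bounded set, so it can be cut down to the
    preimage of [E]. *)
Lemma sub_rectifiable m n (E F : set 'rV[R]_n) :
  E `<=` F -> rectifiable m F -> rectifiable m E.
Proof.
case: m => [|m] EF; first exact: sub_finite_set.
move=> [D [f [/bounded_setP[C C0 DC] /lipschitz_onP[k k0 fk] fD]]].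
exists (D `&` f @^-1` E), f; split.
- by apply/bounded_setP; exists C => // x [/DC].
- by apply/lipschitz_onP; exists k => // x y [Dx _] [Dy _]; exact: fk.
- apply/seteqP; split=> [_ [x [_ Ex] <-]//|y Ey].
  have [x Dx xy] : (f @` D) y by rewrite fD; exact: EF.
  by exists x => //; split=> //=; rewrite xy.
Qed.

(* The second domain is translated by tau, at distance at least 1 from the
   first one; across the gap the glued map is Lipschitz since it is bounded. *)
Lemma rectifiableU m n (E F : set 'rV[R]_n) :
  rectifiable m E -> rectifiable m F -> rectifiable m (E `|` F).
Proof.
case: m => [|m]; first by rewrite /rectifiable finite_setU.
move=> [D1 [f1 [bD1 lf1 fD1]]] [D2 [f2 [bD2 lf2 fD2]]].
have /bounded_setP[c1 c10 cf1] := lipschitz_bounded_image lf1 bD1.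
have /bounded_setP[c2 c20 cf2] := lipschitz_bounded_image lf2 bD2.
move: bD1 bD2 lf1 lf2 => /bounded_setP[C1 C10 DC1] /bounded_setP[C2 C20 DC2].
move=> /lipschitz_onP[k1 k10 fk1] /lipschitz_onP[k2 k20 fk2].
(* [D1] and [D2] have radii at most [C1] and [C2], so this shift leaves a gap of at least 1. *)
pose tau : 'rV[R]_m.+1 := const_mx (C1 + C2 + 1).
have ntau : C1 + C2 + 1 <= `|tau|.
  by have := ler_mx_entry tau 0 0; rewrite mxE ger0_norm//; lra.
have gap w1 w2 : D1 w1 -> D2 w2 -> 1 <= `|w1 - (w2 + tau)|.
  move=> /DC1 w1C /DC2 w2C.
  have := ler_normD (w1 - (w2 + tau)) (w2 - w1).
  have -> : w1 - (w2 + tau) + (w2 - w1) = - tau.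
    by apply/matrixP => i j; rewrite !mxE; ring.
  by rewrite normrN; have := ler_normB w2 w1; lra.
pose f w := if pselect (D1 w) then f1 w else f2 (w - tau).
have fE1 w : D1 w -> f w = f1 w by rewrite /f; case: pselect.
have fE2 w : D2 w -> f (w + tau) = f2 w.
  move=> D2w; rewrite /f; case: pselect => [D1w|?]; last by rewrite addrK.
  by have := gap _ _ D1w D2w; rewrite subrr normr0 ler10.
pose D2' := [set w + tau | w in D2].
exists (D1 `|` D2'), f; split.
- apply/bounded_setP; exists (C1 + C2 + `|tau|).
    by rewrite ltr_pwDl// addr_gt0.
  move=> ? [/DC1 wC|[w /DC2 wC <-]].
    by rewrite (le_trans wC)// -addrA lerDl addr_ge0// ltW.
  by rewrite (le_trans (ler_normD _ _))// lerD2r; lra.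
- apply/lipschitz_onP; exists (k1 + k2 + (c1 + c2)).
    by rewrite !addr_gt0.
  have mixed w1 w2 : D1 w1 -> D2 w2 ->
      `|f1 w1 - f2 w2| <= (k1 + k2 + (c1 + c2)) * `|w1 - (w2 + tau)|.
    move=> D1w D2w; have := gap _ _ D1w D2w.
    set s := `|w1 - _| => s1; rewrite (le_trans (ler_normB _ _))//.
    rewrite (@le_trans _ _ (c1 + c2))//.
      by rewrite lerD ?cf1 ?cf2.
    rewrite -[X in X <= _]mulr1 ler_pM ?addr_ge0 ?(ltW c10) ?(ltW c20)//.
    by rewrite lerDr addr_ge0// ltW.
  move=> w w' [Dw|[v Dv <-]] [Dw'|[v' Dv' <-]].
  + rewrite !fE1// (le_trans (fk1 _ _ Dw Dw'))// ler_wpM2r//; lra.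
  + by rewrite fE1// fE2// mixed.
  + by rewrite (fE1 w')// fE2// distrC [X in _ * X]distrC mixed.
  + rewrite !fE2// opprD [v + tau + _]addrACA subrr addr0.
    by rewrite (le_trans (fk2 _ _ Dv Dv'))// ler_wpM2r//; lra.
- rewrite image_setU -fD1 -fD2; congr (_ `|` _).
    by apply/seteqP; split=> _ [w Dw <-]; exists w; rewrite ?fE1.
  apply/seteqP; split=> [_ [_ [w Dw <-] <-]|_ [w Dw <-]].
    by exists w; rewrite ?fE2.
  by exists (w + tau); rewrite ?fE2//; exists w.
Qed.

Lemma rectifiable_bigcup m n k (E : 'I_k -> set 'rV[R]_n) :
  (forall i, rectifiable m (E i)) ->
  rectifiable m (\bigcup_(i in [set: 'I_k]) E i).
Proof.
elim: k E => [|k IH] E rE.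
  by apply: sub_rectifiable (rectifiable_set0 m n) => x [[]].
have rE' := IH (E \o lift ord0) (fun i => rE _).
apply: sub_rectifiable (rectifiableU (rE ord0) rE') => x [i _].
by case: (unliftP ord0 i) => [j ->|->] Ex; [right; exists j|left].
Qed.

(** Handles dimension 0 uniformly with the others: ['rV_0] has a single point, so its image is
    finite. *)
Lemma rectifiable_sub_lipschitz_image m n (D : set 'rV[R]_m)
    (f : 'rV[R]_m -> 'rV[R]_n) (E : set 'rV[R]_n) :
  bounded_set D -> [lipschitz f w | w in D] -> E `<=` f @` D -> rectifiable m E.
Proof.
case: m D f => [|m] D f bD lf ED; last first.
  by apply: sub_rectifiable ED _; exists D, f.
apply: (@sub_finite_set _ _ [set f 0]); last exact: finite_set1.
by move=> x /ED[w _ <-]; rewrite (thinmx0 w).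
Qed.

(** Near each point the graph parametrization [emb] is Lipschitz, and compactness leaves finitely
    many patches to glue. *)
Lemma rectifiable_sub_hypersurface n (H K : set 'rV[R]_n.+1) :
  lipschitz_hypersurface H -> compact K -> K `<=` H -> rectifiable n K.
Proof.
move=> hH cK KH; apply: compact_local_ind cK.
- exact: rectifiable_set0.
- by move=> *; exact: rectifiableU.
- by move=> A C; exact: sub_rectifiable.
move=> p /KH/hH[U [A [V [f [[oU Up] uA _ /lipschitz_onP[k k0 fk] HU]]]]].
exists (U `&` ball p 1).
  by apply: filterI; [exact: open_nbhs_nbhs|exact: nbhsx_ballx].
pose emb w : 'rV[R]_n.+1 := (row_mx (f w)%:M w : 'rV[R]_(1 + n)) *m A.
have [kA kA0 normA] := mulmx_norm_le A.
have [kI kI0 normI] := mulmx_norm_le (invmx A).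
(* [V] may be unbounded; the preimage of a unit ball is bounded because [invmx A] recovers [w]
   linearly from [emb w]. *)
apply: (@rectifiable_sub_lipschitz_image _ _ (V `&` emb @^-1` ball p 1) emb).
- apply/bounded_setP; exists (kI * (`|p| + 1)).
    by rewrite mulr_gt0// ltr_wpDl.
  move=> w [_ /= pw]; have embw : `|emb w| <= `|p| + 1.
    rewrite -[emb w](subrK p) addrC (le_trans (ler_normD _ _))// lerD2l.
    by move: pw; rewrite -ball_normE /= distrC => /ltW.
  have s0 : 0 <= kI * (`|p| + 1) by rewrite mulr_ge0 ?addr_ge0// ltW.
  have [h _] := row_mx_norm_le (f w)%:M w s0; apply: (proj2 (h _)).
  have := normI _ (emb w); rewrite mulmxK// => /le_trans; apply.
  by rewrite ler_pM2l.
- apply/lipschitz_onP; exists (kA * (k + 1)); first by rewrite mulr_gt0// addr_gt0.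
  move=> w w' [Vw _] [Vw' _]; rewrite -mulmxBl (le_trans (normA _ _))//.
  rewrite -mulrA ler_pM2l//.
  have s0 : 0 <= (k + 1) * `|w - w'| by rewrite mulr_ge0// addr_ge0// ltW.
  have [_ h] := row_mx_norm_le (f w - f w')%:M (w - w') s0.
  rewrite opp_row_mx add_row_mx -raddfB; apply: h.
  rewrite scalar_mx_norm; split.
    by rewrite (le_trans (fk _ _ Vw Vw'))// ler_wpM2r// lerDl.
  by rewrite -[leLHS]mul1r ler_wpM2r// lerDr ltW.
- move=> x [[Ux px] /KH Hx]; have : (H `&` U) x by [].
  by rewrite HU => -[w Vw wx]; exists w => //; split=> //=; rewrite /emb wx.
Qed.

End rectifiable_sets.

Theorem theorem1 (R : realType) (n : nat) (B : set 'rV[R]_n.+1)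
    (c : 'rV[R]_n.+1) (M : set 'rV[R]_n.+1)
    (hB : symmetric_convex_domain B c) (hM : bounded_set M) :
  (exists2 r0 : R, 0 < r0 & forall r : R, r0 < r ->
     lipschitz_hypersurface (level_set B c M r)) /\
  (forall r : R, 0 < r ->
     (exists (k : nat) (S : 'I_k -> set 'rV[R]_n.+1),
        (forall i, lipschitz_hypersurface_piece (S i)) /\
        level_set B c M r = \bigcup_(i in [set: 'I_k]) S i) /\
     rectifiable n (level_set B c M r)).
Proof.
split=> [|r r0].
  have /bounded_setP[C C0 MC] := hM; have [k k0 Nk] := Bnorm_le_norm hB.
  have D0 : 0 < k * (C + C) by rewrite mulr_gt0// addr_gt0.
  (* [M] has [N]-diameter at most [k * (C + C)]. *)
  exists (2 * (k * (C + C))); first exact: mulr_gt0.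
  move=> r Dr; apply: (level_set_lipschitz_hypersurface hB _ _ Dr); last lra.
  move=> m m' Mm Mm'; rewrite (le_trans (Nk _))// ler_pM2l//.
  by rewrite (le_trans (ler_normB _ _))// lerD ?MC.
have [k [S [Sp SE]]] := level_set_pieces hB hM r0.
split; first by exists k, S.
rewrite SE; apply: rectifiable_bigcup => i; have [cS [H hH SH]] := Sp i.
apply: (rectifiable_sub_hypersurface hH) => //.
apply: subclosed_compact cS (level_set_compact hB hM r0) _.
by rewrite SE => x Sx; exists i.
Qed.
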